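(* There is an absolute constant $K>0$ such that for every prime power $q$, every set $\mathcal{C}$ of irreducible conics in $\mathbb{F}_q^2$ and every set $\mathcal{P}$ of points in $\mathbb{F}_q^2$, $$I(\mathcal{P},\mathcal{C})\le K\left(\frac{|\mathcal{P}||\mathcal{C}|}{q}+q^{1/5}|\mathcal{P}|^{4/5}|\mathcal{C}|^{4/5}+|\mathcal{C}|\right).$$
   Context: $\mathbb{F}_q$ is the finite field with $q$ elements. An irreducible conic in $\mathbb{F}_q^2$ is a curve given by $g(x,y)=0$, where $g\in\mathbb{F}_q[x,y]$ is an irreducible polynomial of degree $2$ (two polynomials differing by a nonzero scalar factor give the same conic). The number of incidences is $I(\mathcal{P},\mathcal{C}) := |\{(\boldsymbol{p},C)\in \mathcal{P}\times\mathcal{C} : \boldsymbol{p}\in C\}|$. *)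

(* Defs.v *)
From HB Require Import structures.
From mathcomp Require Import all_boot all_order all_algebra.
From mathcomp Require Import finmap generic_quotient mpoly.

Set Implicit Arguments.
Unset Strict Implicit.
Unset Printing Implicit Defensive.

Import GRing.Theory.
Local Open Scope ring_scope.
Local Open Scope quotient_scope.

Definition irreducible (A : idomainType) (g : A) : Prop :=
  [/\ g != 0, g \isn't a GRing.unit &
      forall a b : A, g = a * b -> a \is a GRing.unit \/ b \is a GRing.unit].

Section PlaneCurves.
Variable F : finFieldType.

Definition proportional (g h : {mpoly F[2]}) : bool :=
  [exists c : F, (c != 0) && (h == c *: g)].

Lemma proportionalP (g h : {mpoly F[2]}) :
  reflect (exists2 c : F, c != 0 & h = c *: g) (proportional g h).
Proof.
apply: (iffP existsP) => [[c /andP[c0 /eqP ->]]|[c c0 ->]]; exists c => //.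
by rewrite c0 eqxx.
Qed.

Lemma proportional_refl : reflexive proportional.
Proof. by move=> g; apply/proportionalP; exists 1; rewrite ?oner_neq0 ?scale1r. Qed.

Lemma proportional_sym : ssrbool.symmetric proportional.
Proof.
have H g h : proportional g h -> proportional h g.
  case/proportionalP=> c c0 ->; apply/proportionalP; exists c^-1.
    by rewrite invr_neq0.
  by rewrite scalerA mulVf // scale1r.
by move=> g h; apply/idP/idP; apply: H.
Qed.

Lemma proportional_trans : transitive proportional.
Proof.
move=> h g k /proportionalP[c c0 ->] /proportionalP[d d0 ->].
by apply/proportionalP; exists (d * c); rewrite ?mulf_neq0 ?scalerA.
Qed.

Canonical proportional_equiv :=
  EquivRel proportional proportional_refl proportional_sym proportional_trans.

(* A plane curve is an equation g(x, y) = 0 up to a nonzero scalar factor; it is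
   not identified with its point set over F, which does not determine it. *)
Definition curve := {eq_quot proportional}.

HB.instance Definition _ := EqQuotient.on curve.
HB.instance Definition _ := Choice.on curve.

Definition curve_of (g : {mpoly F[2]}) : curve := \pi_curve g.

Lemma curve_of_eq (g h : {mpoly F[2]}) :
  curve_of g = curve_of h <-> exists2 c : F, c != 0 & h = c *: g.
Proof.
have E : (curve_of g == curve_of h) = proportional g h by exact: eqmodE.
split=> [/eqP|/proportionalP]; first by rewrite E => /proportionalP.
by rewrite -E => /eqP.
Qed.

(* msize is one more than the total degree. *)
Definition irreducible_conic (C : curve) : Prop :=
  exists g : {mpoly F[2]},
    [/\ C = curve_of g, msize g = 3%N & irreducible g].

Definition on_curve (p : 'rV[F]_2) (C : curve) : bool :=
  (repr C).@[p ord0] == 0.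

Lemma on_curve_of (p : 'rV[F]_2) (g : {mpoly F[2]}) :
  on_curve p (curve_of g) = (g.@[p ord0] == 0).
Proof.
have [c c0 gE] : exists2 c : F, c != 0 & g = c *: repr (curve_of g).
  by apply/curve_of_eq; rewrite [LHS]reprK.
by rewrite [in RHS]gE mevalZ mulf_eq0 (negPf c0).
Qed.

Definition incidences (P : {fset 'rV[F]_2}) (Cs : {fset curve}) : nat :=
  #|` [fset pC in (P `*` Cs)%fset | on_curve pC.1 pC.2]%fset |.

End PlaneCurves.

(* Main.v *)
Require Import Defs.
From mathcomp Require Import all_boot all_order all_algebra.
From mathcomp Require Import finmap mpoly ring lra.
From mathcomp Require Import reals exp.

(** Write n_C for the number of points of P on C. Fix a noncollinear triple
    a, b, c in P, and let Q be the points of P on none of its three sides.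
    Vanishing at two distinct points of Q imposes independent linear conditions
    on the quadratic polynomials that vanish at a, b, c, so the numbers of
    points of Q on these curves have the variance of a pairwise independent
    family, at most |Q|/q. An irreducible conic has no three collinear points,
    so one through a, b, c contains n_C - 3 points of Q; this deviates from the
    mean |Q|/q by at least n_C / 2 when n_C >= 12 and n_C >= 4|P|/q. Summing over
    all triples bounds the sum of n_C^5 over such conics by O(q |P|^4), and
    n <= t + n^5 / t^4 with t = q^(1/5) |P|^(4/5) |C|^(-1/5) concludes. Every
    conic is counted through its q - 1 equations. *)

Set Implicit Arguments.
Unset Strict Implicit.
Unset Printing Implicit Defensive.
Import Order.TTheory GRing.Theory Num.Theory.
Local Open Scope ring_scope.

(** Dividing the difference of two equations by the difference of their roots lowers the degree;
    this works in every characteristic. *)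
Lemma quadratic_three_roots (F : fieldType) (A B C r s t : F) :
  r != s -> r != t -> s != t ->
  A + B * r + C * r ^+ 2 = 0 -> A + B * s + C * s ^+ 2 = 0 ->
  A + B * t + C * t ^+ 2 = 0 -> [/\ A = 0, B = 0 & C = 0].
Proof.
move=> rs rt st er es et.
have slope x y : x != y -> A + B * x + C * x ^+ 2 = 0 ->
    A + B * y + C * y ^+ 2 = 0 -> B + C * (x + y) = 0.
  move=> xy ex ey; apply: (mulfI (_ : x - y != 0)); first by rewrite subr_eq0.
  rewrite mulr0 -[RHS](subrr 0) -{1}ex -ey; ring.
have C0 : C = 0.
  apply: (mulfI (_ : s - t != 0)); first by rewrite subr_eq0.
  by rewrite mulr0 -[RHS](subrr 0) -{1}(slope r s) // -(slope r t) //; ring.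
have B0 : B = 0 by rewrite -(slope r s) // C0; ring.
by split=> //; rewrite -er B0 C0; ring.
Qed.

(** * Quadratic polynomials in the plane *)

Section Quadratics.
Variable F : finFieldType.
Implicit Types (a b c p : 'rV[F]_2) (w : 'rV[F]_6).

Local Notation X := ('X_(0 : 'I_2) : {mpoly F[2]}).
Local Notation Y := ('X_(1 : 'I_2) : {mpoly F[2]}).

(** Coefficient vectors make the polynomials of degree at most 2, degenerate ones included, a vector
    space with q^6 elements, which can be counted. *)
Definition quad w : {mpoly F[2]} :=
  \sum_i w 0 i *: nth 0 [:: 1; X; Y; X ^+ 2; X * Y; Y ^+ 2] i.

Definition qeval w p : F :=
  \sum_i w 0 i * nth 0 [:: 1; p 0 0; p 0 1; p 0 0 ^+ 2; p 0 0 * p 0 1; p 0 1 ^+ 2] i.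

Lemma meval_quad w p : (quad w).@[p ord0] = qeval w p.
Proof.
rewrite /quad /qeval raddf_sum; apply: eq_bigr => i _.
rewrite /= mevalZ; congr (_ * _).
by case: i; do 6?[case=> [|//]] => * /=;
  rewrite ?mevalM ?mevalXU ?meval1 //= !mevalXU.
Qed.

Lemma quadZ k w : quad (k *: w) = k *: quad w.
Proof.
by rewrite /quad scaler_sumr; apply: eq_bigr => i _; rewrite mxE scalerA.
Qed.

Lemma quadD w w' : quad (w + w') = quad w + quad w'.
Proof.
by rewrite /quad -big_split; apply: eq_bigr => i _; rewrite mxE scalerDl.
Qed.

Lemma quad0 : quad 0 = 0.
Proof. by rewrite /quad big1 // => i _; rewrite mxE scale0r. Qed.

Lemma quad_inj : injective quad.
Proof.
pose x : 'X_{1..2} := U_((0 : 'I_2)%R)%MM; pose y : 'X_{1..2} := U_((1 : 'I_2)%R)%MM.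
pose ms : seq 'X_{1..2} := [:: 0; x; y; x *+ 2; x + y; y *+ 2]%MM.
have ms_uniq : uniq ms.
  apply: (@map_uniq _ _ (fun m : 'X_{1..2} => (m 0, m 1))).
  by rewrite /= !(mnmDE, mulmnE, mnm1E, mnm0E).
have quadE w : quad w = \sum_i w 0 i *: 'X_[nth 0%MM ms i].
  apply: eq_bigr => i _; congr (_ *: _).
  by case: i; do 6?[case=> [|//]] => * /=; rewrite /ms /= ?mpolyX0 ?mpolyXD ?expr2.
move=> w w' ww'; apply/rowP => i.
have coef v : (quad v)@_(nth 0%MM ms i) = v 0 i.
  rewrite quadE raddf_sum (bigD1 i) //= mcoeffZ mcoeffX eqxx mulr1 big1 ?addr0 // => j ji.
  by rewrite mcoeffZ mcoeffX nth_uniq // (inj_eq val_inj) (negPf ji) mulr0.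
by rewrite -!coef ww'.
Qed.

Lemma qevalZ k w p : qeval (k *: w) p = k * qeval w p.
Proof. by rewrite -!meval_quad quadZ mevalZ. Qed.

Lemma qevalD w w' p : qeval (w + w') p = qeval w p + qeval w' p.
Proof. by rewrite -!meval_quad quadD mevalD. Qed.

Lemma msize_le3_quad (g : {mpoly F[2]}) : (msize g <= 3)%N -> exists w, g = quad w.
Proof.
move=> /mpolywE ->; apply: (big_ind (fun h => exists w, h = quad w)).
- by exists 0; rewrite quad0.
- by move=> _ _ [w ->] [w' ->]; exists (w + w'); rewrite quadD.
move=> [m /= m3] _; suff [w ->] : exists w, 'X_[m] = quad w.
  by exists (g@_m *: w); rewrite quadZ.
suff [i ->] : exists i : 'I_6, 'X_[m] = nth 0
    [:: 1; X; Y; X ^+ 2; X * Y; Y ^+ 2] i.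
  exists (delta_mx 0 i); rewrite /quad (bigD1 i) //= big1 => [|j ji].
    by rewrite mxE !eqxx scale1r addr0.
  by rewrite mxE (negPf ji) andbF scale0r.
rewrite mpolyXE_id; move: m3; rewrite mdegE !big_ord_recl !big_ord0.
rewrite -[ord0]/(0 : 'I_2) (_ : lift 0 0 = 1 :> 'I_2); last exact/val_inj.
rewrite addn0 mulr1.
(* Total degree below 3 leaves six exponent pairs; each witness is the position of the monomial in
   the list. *)
case: (m 0) => [|[|[|]]] //; case: (m 1) => [|[|[|]]] // _.
- by exists (inord 0); rewrite inordK //= mulr1.
- by exists (inord 2); rewrite inordK //= mul1r expr1.
- by exists (inord 5); rewrite inordK //= mul1r.
- by exists (inord 1); rewrite inordK //= mulr1 expr1.
- by exists (inord 4); rewrite inordK //= !expr1.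
- by exists (inord 3); rewrite inordK //= mulr1.
Qed.

(** * Irreducible conics and lines *)

Lemma msize_affine (k l m : F) :
  (msize (k%:MP + l *: X + m *: Y) <= 2)%N.
Proof.
apply: (leq_trans (msizeD_le _ _)); rewrite geq_max.
rewrite (leq_trans (msizeZ_le _ _)) ?msizeX ?mdeg1 // andbT.
apply: (leq_trans (msizeD_le _ _)); rewrite geq_max.
rewrite (leq_trans (msizeZ_le _ _)) ?msizeX ?mdeg1 // andbT.
by rewrite msizeC; case: (k != 0).
Qed.

(** A unit factor is a nonzero constant, of [msize] 1, so the other factor would need [msize] 3. *)
Lemma irreducible_conic_not_reducible (g h k : {mpoly F[2]}) :
  irreducible g -> msize g = 3%N -> (msize h <= 2)%N -> (msize k <= 2)%N -> g <> h * k.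
Proof.
move=> [g0 _ irr] g3 h2 k2 ghk.
have [h0 k0] : h != 0 /\ k != 0.
  by apply/andP; rewrite -negb_or -mulf_eq0 -ghk.
have := g3; rewrite ghk msizeM //.
have nunit (l : {mpoly F[2]}) : l \is a GRing.unit -> msize l = 1%N.
  by move=> /andP[/eqP lE lU]; rewrite lE msizeC; case: eqP lU => [->|//]; rewrite unitr0.
by case: (irr _ _ ghk) => /nunit ->; move: h2 k2;
  case: (msize h) => [|[|[|]]] //; case: (msize k) => [|[|[|]]].
Qed.

Lemma point_eq (p p' : 'rV[F]_2) : p 0 0 = p' 0 0 -> p 0 1 = p' 0 1 -> p = p'.
Proof.
move=> e0 e1; apply/rowP=> -[[|[|//]] i2].
  by rewrite (_ : Ordinal i2 = 0) //; apply/val_inj.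
by rewrite (_ : Ordinal i2 = 1) //; apply/val_inj.
Qed.

(* Twice the signed area of the triangle abp: as a function of p, an equation
   of the line through a and b. *)
Definition area a b p : F :=
  (b 0 0 - a 0 0) * (p 0 1 - a 0 1) - (b 0 1 - a 0 1) * (p 0 0 - a 0 0).

(** With the coefficients as plain variables and constant polynomials, [ring] can check the
    factorizations below. *)
Lemma quad_expand w : exists a0 a1 a2 a3 a4 a5 : F,
  quad w = a0%:MP + a1%:MP * X + a2%:MP * Y + a3%:MP * X ^+ 2
           + a4%:MP * (X * Y) + a5%:MP * Y ^+ 2 /\
  forall p, qeval w p = a0 + a1 * p 0 0 + a2 * p 0 1 + a3 * p 0 0 ^+ 2
           + a4 * (p 0 0 * p 0 1) + a5 * p 0 1 ^+ 2.
Proof.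
do 6!eexists; split=> [|p].
  by rewrite /quad !big_ord_recl big_ord0 /= -!mul_mpolyC addr0 !addrA mulr1.
by rewrite /qeval !big_ord_recl big_ord0 /= addr0 !addrA mulr1.
Qed.

(** Restricted to a line through three of its zeros, the polynomial becomes a quadratic in one
    variable with three roots, hence zero. The equation of the line then divides it, against
    irreducibility. *)
Lemma irreducible_conic_no_three_collinear w a b c :
  irreducible (quad w) -> msize (quad w) = 3%N ->
  a != b -> a != c -> b != c ->
  qeval w a = 0 -> qeval w b = 0 -> qeval w c = 0 -> area a b c != 0.
Proof.
move=> irr sz ab ac bc.
have [a0 [a1 [a2 [a3 [a4 [a5 [qE qeE]]]]]]] := quad_expand w.
rewrite !qeE => wa wb wc; apply/negP => /eqP abc0.
have nred h k := @irreducible_conic_not_reducible (quad w) h k irr sz.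
(* A vertical line is parametrized by its second coordinate; any other line is y = u x + v. *)
have [ab0|ab0] := eqVneq (a 0 0) (b 0 0).
- have ab1 : a 0 1 != b 0 1 by apply: contraNneq ab => ab1; apply/eqP/point_eq.
  have ac0 : c 0 0 = a 0 0.
    move/eqP: abc0; rewrite /area ab0 subrr mul0r sub0r oppr_eq0 mulf_eq0.
    by rewrite !subr_eq0 eq_sym (negPf ab1) => /eqP.
  have ac1 : a 0 1 != c 0 1 by apply: contraNneq ac => ac1; apply/eqP/point_eq.
  have bc1 : b 0 1 != c 0 1.
    by apply: contraNneq bc => bc1; apply/eqP/point_eq => //; rewrite ac0.
  have [||| e0 e1 e2] := @quadratic_three_roots F
    (a0 + a1 * a 0 0 + a3 * a 0 0 ^+ 2) (a2 + a4 * a 0 0) a5 _ _ _ ab1 ac1 bc1.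
  + by rewrite -[RHS]wa; ring.
  + by rewrite -[RHS]wb -ab0; ring.
  + by rewrite -[RHS]wc ac0; ring.
  (* The first factor is the line x - a_x; the second is the quotient left once the three restricted
     coefficients vanish. *)
  apply: (nred _ _ (msize_affine (- a 0 0) 1 0)
                   (msize_affine (a1 + a3 * a 0 0) a3 a4)).
  have e0' : a0 = - (a1 * a 0 0 + a3 * a 0 0 ^+ 2) by rewrite -[RHS]addr0 -e0; ring.
  have e1' : a2 = - (a4 * a 0 0) by rewrite -[RHS]addr0 -e1; ring.
  rewrite qE e0' e1' e2 -!mul_mpolyC.
  rewrite !expr2 !(mpolyCN, mpolyCD, mpolyCM, mpolyC0, mpolyC1); ring.
pose u := (b 0 1 - a 0 1) / (b 0 0 - a 0 0); pose v := a 0 1 - u * a 0 0.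
have d0 : b 0 0 - a 0 0 != 0 by rewrite subr_eq0 eq_sym.
have onl p : area a b p = 0 -> p 0 1 = u * p 0 0 + v.
  move=> pl; apply: (mulfI d0); rewrite -[LHS]subr0 -{1}pl /area /v /u; field.
  exact: d0.
have aE : a 0 1 = u * a 0 0 + v by rewrite /v; ring.
have bE : b 0 1 = u * b 0 0 + v by apply: onl; rewrite /area; ring.
have cE := onl _ abc0.
have ac0 : a 0 0 != c 0 0.
  by apply: contraNneq ac => ac0; apply/eqP/point_eq; rewrite // aE cE ac0.
have bc0 : b 0 0 != c 0 0.
  by apply: contraNneq bc => bc0; apply/eqP/point_eq; rewrite // bE cE bc0.
have [||| e0 e1 e2] := @quadratic_three_roots F
    (a0 + a2 * v + a5 * v ^+ 2) (a1 + a2 * u + a4 * v + 2 * a5 * u * v)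
    (a3 + a4 * u + a5 * u ^+ 2) _ _ _ ab0 ac0 bc0.
- by rewrite -[RHS]wa aE; ring.
- by rewrite -[RHS]wb bE; ring.
- by rewrite -[RHS]wc cE; ring.
(* Here the line is y - u x - v. *)
apply: (nred _ _ (msize_affine (- v) (- u) 1)
                 (msize_affine (a2 + a5 * v) (a4 + a5 * u) a5)).
have e0' : a0 = - (a2 * v + a5 * v ^+ 2) by rewrite -[RHS]addr0 -e0; ring.
have e1' : a1 = - (a2 * u + a4 * v + 2 * a5 * u * v).
  by rewrite -[RHS]addr0 -e1; ring.
have e2' : a3 = - (a4 * u + a5 * u ^+ 2) by rewrite -[RHS]addr0 -e2; ring.
rewrite qE e0' e1' e2' -!mul_mpolyC mulr_natl.
rewrite !expr2 !(mpolyCN, mpolyCD, mpolyCM, mpolyCMn, mpolyC1); ring.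
Qed.

(** * Independence of the conditions imposed by points *)

Lemma areaC a b c : area b c a = area a b c.
Proof. rewrite /area; ring. Qed.

Lemma area_l a b : area a b a = 0.
Proof. rewrite /area; ring. Qed.

Lemma area_r a b : area a b b = 0.
Proof. rewrite /area; ring. Qed.

(** Pairs of lines serve below as quadratics that vanish at prescribed points and not at a new one.
    The coefficients come from expanding the product, [area a b 0] being the constant term of the
    first line. *)
Lemma two_lines a b c d : exists w, forall p, qeval w p = area a b p * area c d p.
Proof.
exists (\row_i nth 0 [:: area a b 0 * area c d 0;
  - area a b 0 * (d 0 1 - c 0 1) - area c d 0 * (b 0 1 - a 0 1);
  area a b 0 * (d 0 0 - c 0 0) + area c d 0 * (b 0 0 - a 0 0);
  (b 0 1 - a 0 1) * (d 0 1 - c 0 1);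
  - (b 0 1 - a 0 1) * (d 0 0 - c 0 0) - (b 0 0 - a 0 0) * (d 0 1 - c 0 1);
  (b 0 0 - a 0 0) * (d 0 0 - c 0 0)] i) => p.
rewrite /qeval !big_ord_recl big_ord0 !mxE /= /area !mxE; ring.
Qed.

Definition vanishing (s : seq 'rV[F]_2) := [set w | all (fun p => qeval w p == 0) s].

Lemma card_vanishing_nil : #|vanishing [::]| = (#|F| ^ 6)%N.
Proof. by rewrite /vanishing cardsE card_mx mul1n. Qed.

(** Values at [p] are equidistributed on [vanishing s]: translation by the multiple of [w] with
    value [k] at [p] carries the zero fibre onto the fibre of [k]. *)
Lemma card_vanishing_cons p s w :
  w \in vanishing s -> qeval w p != 0 ->
  #|vanishing s| = (#|F| * #|vanishing (p :: s)|)%N.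
Proof.
move=> ws wp.
rewrite -sum1_card (partition_big (qeval^~ p) predT) //= -sum_nat_const.
apply: eq_bigr => k _; pose v := (k / qeval w p) *: w.
rewrite -sum1_card (reindex_onto (fun u => u + v) (fun u => u - v)) => [|u _];
  last exact: subrK.
apply: eq_bigl => u; rewrite addrK eqxx andbT !inE qevalD qevalZ mulfVK //.
rewrite -{2}(add0r k) (inj_eq (addIr k)) andbC; congr (_ && _).
apply: eq_in_all => r rs; rewrite qevalD qevalZ.
by move: ws; rewrite inE => /allP/(_ _ rs)/eqP ->; rewrite mulr0 addr0.
Qed.

(** The points are imposed one at a time; the witness for each is a side through the other two
    vertices, taken twice. *)
Lemma card_vanishing3 a b c :
  area a b c != 0 -> #|vanishing [:: a; b; c]| = (#|F| ^ 3)%N.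
Proof.
move=> abc; have F0 : (0 < #|F|)%N by apply/card_gt0P; exists 0.
apply/eqP; rewrite -(@eqn_pmul2l (#|F| ^ 3)) ?expn_gt0 ?F0 // -expnD -card_vanishing_nil.
rewrite 2!expnS expn1 -!mulnA.
have [w0 w0E] := two_lines a b a b.
rewrite (@card_vanishing_cons c [::] w0)
  ?inE //; last by rewrite w0E mulf_neq0.
have [w1 w1E] := two_lines a c a c.
have acb : area a c b != 0.
  by apply: contraNneq abc => acb; rewrite -oppr_eq0 -acb /area; apply/eqP; ring.
rewrite (@card_vanishing_cons b [:: c] w1)
  ?inE /= ?w1E ?area_r ?mulf_neq0 ?mul0r ?eqxx //.
have bca : area b c a != 0 by rewrite areaC.
have [w2 w2E] := two_lines b c b c.
by rewrite (@card_vanishing_cons a [:: b; c] w2)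
  ?inE /= ?w2E ?area_l ?area_r ?mulf_neq0 ?mul0r ?eqxx.
Qed.

(** The sides ab and ca together contain the triangle's vertices and miss [p]. *)
Lemma card_vanishing4 a b c p :
  area a b c != 0 -> area a b p != 0 -> area c a p != 0 ->
  #|vanishing [:: p; a; b; c]| = (#|F| ^ 2)%N.
Proof.
move=> abc abp cap; have F0 : (0 < #|F|)%N by apply/card_gt0P; exists 0.
apply/eqP; rewrite -(eqn_pmul2l F0) -expnS -(card_vanishing3 abc).
have [w wE] := two_lines a b c a.
by rewrite (@card_vanishing_cons p [:: a; b; c] w)
  ?inE /= ?wE ?area_l ?area_r ?mulf_neq0 ?mul0r ?mulr0 ?eqxx.
Qed.

(** Each coordinate of p' - p, times [area b c p], is a combination of the two given areas, and one
    coordinate is nonzero. *)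
Lemma area_eq0_2 b c p p' :
  p != p' -> area b p p' = 0 -> area c p p' = 0 -> area b c p = 0.
Proof.
move=> pp' bp cp.
have [d0|d0] := eqVneq (p' 0 0) (p 0 0); last first.
  apply: (mulfI (_ : p' 0 0 - p 0 0 != 0)); first by rewrite subr_eq0.
  transitivity ((p 0 0 - c 0 0) * area b p p' - (p 0 0 - b 0 0) * area c p p').
    by rewrite /area; ring.
  by rewrite bp cp !mulr0 subrr.
have [d1|d1] := eqVneq (p' 0 1) (p 0 1).
  by case/eqP: pp'; apply: point_eq.
apply: (mulfI (_ : p' 0 1 - p 0 1 != 0)); first by rewrite subr_eq0.
transitivity ((p 0 1 - c 0 1) * area b p p' - (p 0 1 - b 0 1) * area c p p').
  by rewrite /area; ring.
by rewrite bp cp !mulr0 subrr.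
Qed.

(** The witness is ab with cp, or ca with bp if [p'] lies on cp. It cannot lie on both cp and bp,
    since [b], [c], [p] are not collinear. *)
Lemma card_vanishing5 a b c p p' :
  area a b c != 0 -> area a b p != 0 -> area b c p != 0 -> area c a p != 0 ->
  area a b p' != 0 -> area c a p' != 0 -> p != p' ->
  #|vanishing [:: p'; p; a; b; c]| = #|F|.
Proof.
move=> abc abp bcp cap abp' cap' pp'.
have F0 : (0 < #|F|)%N by apply/card_gt0P; exists 0.
apply/eqP; rewrite -(eqn_pmul2l F0) mulnn -(card_vanishing4 abc abp cap).
have [cpp'|cpp'] := eqVneq (area c p p') 0.
  have bpp' : area b p p' != 0.
    by apply: contraNneq bcp => bpp'; apply/eqP/(area_eq0_2 pp').
  have [w wE] := two_lines c a b p.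
  by rewrite (@card_vanishing_cons p' [:: p; a; b; c] w)
    ?inE /= ?wE ?area_l ?area_r ?mulf_neq0 ?mul0r ?mulr0 ?eqxx.
have [w wE] := two_lines a b c p.
by rewrite (@card_vanishing_cons p' [:: p; a; b; c] w)
  ?inE /= ?wE ?area_l ?area_r ?mulf_neq0 ?mul0r ?mulr0 ?eqxx.
Qed.

End Quadratics.

(** * Variance of the number of zeros *)

Section Moment.
Variables (R : realFieldType) (F : finFieldType).
Implicit Types (a b c p : 'rV[F]_2) (w : 'rV[F]_6) (P : {set 'rV[F]_2}).
Let q : R := #|F|%:R.

Let q_gt0 : 0 < q.
Proof. by rewrite ltr0n; apply/card_gt0P; exists 0. Qed.

Lemma sum_vanishing s p :
  \sum_(w in vanishing s) (qeval w p == 0)%:R = #|vanishing (p :: s)|%:R :> R.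
Proof.
rewrite -natr_sum -sum1_card; congr (_%:R).
rewrite [RHS](eq_bigl (fun w => (w \in vanishing s) && (qeval w p == 0))) => [|w].
  by rewrite big_mkcondr; apply: eq_bigr => w _; case: ifP.
by rewrite !inE andbC.
Qed.

(** Among the q^3 quadratics through the triangle, q^2 vanish at a given point of [P] and q at two
    distinct ones. On expanding the square, the terms in |P|^2 cancel. *)
Lemma second_moment a b c P :
  area a b c != 0 ->
  {in P, forall p, [&& area a b p != 0, area b c p != 0 & area c a p != 0]} ->
  \sum_(w in vanishing [:: a; b; c])
    (\sum_(p in P) (qeval w p == 0)%:R - #|P|%:R / q) ^+ 2 <= q ^+ 2 * #|P|%:R.
Proof.
move=> abc Pabc; set V := vanishing _; set m : R := #|P|%:R.
pose N w : R := \sum_(p in P) (qeval w p == 0)%:R.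
have sN : \sum_(w in V) N w = m * q ^+ 2.
  rewrite exchange_big /= /m mulr_natl -sumr_const; apply: eq_bigr => p pP.
  have /and3P[abp _ cap] := Pabc _ pP.
  by rewrite sum_vanishing card_vanishing4 // natrX.
have sN2 : \sum_(w in V) N w ^+ 2 <= m * (m * q + q ^+ 2).
  under eq_bigr do rewrite expr2 big_distrlr /=.
  rewrite exchange_big /= [leRHS]mulr_natl -sumr_const.
  apply: ler_sum => p pP; rewrite exchange_big /=.
  have /and3P[abp bcp cap] := Pabc _ pP.
  (* Diagonal pairs get a spare q, so that the bound splits as a sum over all p'. *)
  have -> : m * q + q ^+ 2 = \sum_(p' in P) (q + (p' == p)%:R * q ^+ 2).
    rewrite big_split /= sumr_const -mulr_natl; congr (_ + _).
    rewrite (bigD1 p) //= eqxx mul1r big1 ?addr0 // => p' /andP[_ /negPf ->].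
    by rewrite mul0r.
  apply: ler_sum => p' p'P.
  have /and3P[abp' _ cap'] := Pabc _ p'P.
  have [->|p'p] := eqVneq p' p.
    under eq_bigr => w _ do rewrite -natrM mulnb andbb.
    rewrite sum_vanishing card_vanishing4 // natrX mul1r lerDr; exact: ltW.
  rewrite mul0r addr0 /q -(@card_vanishing5 F a b c p p') //; last by rewrite eq_sym.
  rewrite -sum_vanishing [leLHS]big_mkcond [leRHS]big_mkcond /=.
  apply: ler_sum => w _; rewrite !inE /=; case: (qeval w p == 0) => /=.
    by rewrite mul1r.
  by rewrite mul0r; case: ifP.
under eq_bigr => w _.
  rewrite -/(N w) (_ : _ ^+ 2 = N w ^+ 2 + (- (2 * (m / q)) * N w + (m / q) ^+ 2)).
    over.
  by ring.
rewrite !big_split /= -mulr_sumr sN sumr_const /V card_vanishing3 //.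
rewrite -[_ *+ (#|F| ^ 3)]mulr_natl natrX.
rewrite (_ : q ^+ 2 * m = m * (m * q + q ^+ 2) +
  (- (2 * (m / q)) * (m * q ^+ 2) + q ^+ 3 * (m / q) ^+ 2)) ?lerD2r //.
by field; rewrite gt_eqF.
Qed.

(** * From variance to fifth powers *)

Definition zeros P w := [set p in P | qeval w p == 0].

Definition no_three_collinear w := forall a b c,
  a != b -> a != c -> b != c ->
  qeval w a = 0 -> qeval w b = 0 -> qeval w c = 0 -> area a b c != 0.

Definition off_sides P a b c :=
  [set p in P | [&& area a b p != 0, area b c p != 0 & area c a p != 0]].

(** For a noncollinear triple, the subtracted term is the mean of the sum over all quadratics
    through the triple. *)
Definition deviation P w (t : 'rV[F]_2 * 'rV[F]_2 * 'rV[F]_2) : R :=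
  let Q := off_sides P t.1.1 t.1.2 t.2 in
  \sum_(p in Q) (qeval w p == 0)%:R - #|Q|%:R / q.

Definition distinct_triples (T : finType) (Z : {set T}) : pred (T * T * T) :=
  fun t => [&& t.1.1 \in Z, t.1.2 \in Z :\ t.1.1 & t.2 \in Z :\ t.1.1 :\ t.1.2].

Lemma card_distinct_triples (T : finType) (Z : {set T}) :
  #|distinct_triples Z| = (#|Z| * #|Z|.-1 * #|Z|.-2)%N.
Proof.
have cD (S : {set T}) x : x \in S -> #|S :\ x| = #|S|.-1.
  by move=> xS; rewrite (cardsD1 x S) xS.
transitivity (\sum_(t : T * T * T | ((t.1.1 \in Z) && (t.1.2 \in Z :\ t.1.1)) &&
                                        (t.2 \in Z :\ t.1.1 :\ t.1.2)) 1)%N.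
  by rewrite -sum1_card; apply: eq_bigl => t; rewrite -andbA.
rewrite -(pair_big_dep (fun u => (u.1 \in Z) && (u.2 \in Z :\ u.1))
  (fun u z => z \in Z :\ u.1 :\ u.2) (fun _ _ => 1%N)) /=.
have <- : (\sum_(u : T * T | (u.1 \in Z) && (u.2 \in Z :\ u.1)) 1 = #|Z| * #|Z|.-1)%N.
  rewrite -(pair_big_dep (fun x => x \in Z) (fun x y => y \in Z :\ x)
    (fun _ _ => 1%N)) /=.
  by rewrite -sum_nat_const; apply: eq_bigr => x xZ; rewrite sum1_card cD.
rewrite big_distrl; apply: eq_bigr => u /andP[uZ uZ2].
by rewrite sum1_card cD // cD //= mul1n.
Qed.

(** Each of the n(n - 1)(n - 2) ordered triples of zeros has deviation at least n/2. *)
Lemma rich_fifth_power P w :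
  no_three_collinear w -> let n : R := #|zeros P w|%:R in
  12 <= n -> 4 * #|P|%:R / q <= n ->
  n ^+ 5 <= 8 * \sum_(t | distinct_triples (zeros P w) t) deviation P w t ^+ 2.
Proof.
move=> w3 n n12 nP.
have n3 : (12 <= #|zeros P w|)%N by rewrite -(ler_nat R).
have dev t : distinct_triples (zeros P w) t -> (n / 2) ^+ 2 <= deviation P w t ^+ 2.
  case: t => [[a b] c] /and3P[/= aZ bZ cZ].
  move: (aZ) (bZ) (cZ); rewrite !inE.
  move=> /andP[aP /eqP wa] /andP[ba /andP[bP /eqP wb]] /and3P[cb ca /andP[cP /eqP wc]].
  have abc : area a b c != 0 by apply: w3; rewrite // eq_sym.
  rewrite /deviation /=; set Q := off_sides _ _ _ _.
  (* The vertices lie on sides, while any other zero is off all sides because no three zeros are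
     collinear. *)
  have -> : \sum_(p in Q) (qeval w p == 0)%:R = n - 3 :> R.
    rewrite -natr_sum.
    have -> : (\sum_(p in Q) (qeval w p == 0%R) = #|zeros P w :\ a :\ b :\ c|)%N.
      rewrite -sum1_card.
      rewrite [RHS](eq_bigl (fun p => (p \in Q) && (qeval w p == 0))) => [|p].
        by rewrite big_mkcondr; apply: eq_bigr => p _; case: ifP.
      rewrite !inE -!andbA; have [wp|] := eqVneq (qeval w p) 0%R; last by rewrite !andbF.
      rewrite !andbT; case: (p \in P); last by rewrite !andbF.
      rewrite andbT /=.
      have [->|pc] := eqVneq p c; first by rewrite area_r !eqxx andbF.
      have [->|pb] := eqVneq p b; first by rewrite area_r !eqxx andbF.
      have [->|pa] := eqVneq p a; first by rewrite area_l !eqxx !andbF.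
      by rewrite !w3 // eq_sym.
    have -> : n = #|zeros P w :\ a :\ b :\ c|%:R + 3.
      by rewrite /n (cardsD1 a) aZ (cardsD1 b) bZ (cardsD1 c) cZ addrC -natrD.
    by rewrite addrK.
  have Qq : #|Q|%:R / q <= n / 4.
    apply: le_trans (_ : #|P|%:R / q <= _).
      rewrite ler_pM2r ?invr_gt0 // ler_nat subset_leq_card //.
      by apply/subsetP => p; rewrite inE => /andP[].
    by rewrite ler_pdivlMr // mulrC mulrA.
  (* The assumption n >= 12 is what gives n - 3 - n/4 >= n/2. *)
  by rewrite lerXn2r ?nnegrE //; lra.
apply: le_trans (_ : 8 * (n * (n - 1) * (n - 2) * (n / 2) ^+ 2) <= _).
  (* This is the difference 2n^3(n - 1)(n - 2) - n^5. *)
  have : 0 <= n ^+ 3 * (n * (n - 6) + 4) by rewrite mulr_ge0 ?exprn_ge0 //; nra.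
  nra.
rewrite ler_pM2l //.
have -> : n * (n - 1) * (n - 2) = #|distinct_triples (zeros P w)|%:R.
  rewrite card_distinct_triples !natrM /n; move: n3.
  by case: #|_| => [|[|k]] // _; rewrite /= -[k.+2%:R]natr1 -[k.+1%:R]natr1; ring.
rewrite -sum1_card natr_sum mulr_suml; apply: ler_sum => t tZ.
by rewrite mul1r dev.
Qed.

Lemma le_sum_subpred (I : finType) (A B : pred I) (f : I -> R) :
  subpred A B -> (forall i, 0 <= f i) -> \sum_(i | A i) f i <= \sum_(i | B i) f i.
Proof.
move=> AB f0; rewrite !(big_mkcond _ f); apply: ler_sum => i _.
by have := AB i; case: (A i) => [->//|_]; case: ifP.
Qed.

(** After exchanging the sums, each of the at most |P|^3 noncollinear triples contributes at most
    its full second moment, q^2 |P|. *)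
Lemma sum_fifth_powers P (A : {set 'rV[F]_6}) :
  {in A, forall w, no_three_collinear w} ->
  \sum_(w in A) \sum_(t | distinct_triples (zeros P w) t) deviation P w t ^+ 2
    <= q ^+ 2 * #|P|%:R ^+ 4.
Proof.
move=> A3; pose T : pred ('rV[F]_2 * 'rV[F]_2 * 'rV[F]_2) := fun t =>
  [&& t.1.1 \in P, t.1.2 \in P, t.2 \in P & area t.1.1 t.1.2 t.2 != 0].
have AT w t : w \in A -> distinct_triples (zeros P w) t ->
    T t /\ w \in vanishing [:: t.1.1; t.1.2; t.2].
  case: t => [[a b] c] wA; rewrite /distinct_triples /T !inE /=.
  move=> /and3P[/andP[aP wa] /andP[ba /andP[bP wb]] /and3P[cb ca /andP[cP wc]]].
  rewrite aP bP cP wa wb wc; split=> //=.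
  by apply: (A3 w); rewrite 1?eq_sym //; apply/eqP.
rewrite (exchange_big_dep T) /=; last by move=> w t wA /AT[].
apply: le_trans (_ : \sum_(t | T t) q ^+ 2 * #|P|%:R <= _).
  apply: ler_sum => -[[a b] c] /and4P[/= aP bP cP abc].
  apply: le_trans (_ : \sum_(w in vanishing [:: a; b; c])
                         deviation P w (a, b, c) ^+ 2 <= _).
    apply: le_sum_subpred => w; last exact: sqr_ge0.
    by move=> /andP[wA /AT[]].
  apply: (le_trans (second_moment abc _)).
    by move=> p; rewrite inE => /andP[].
  rewrite ler_pM2l ?exprn_gt0 // ler_nat subset_leq_card //.
  by apply/subsetP => p; rewrite inE => /andP[].
rewrite sumr_const -[leLHS]mulr_natl.
have -> : q ^+ 2 * #|P|%:R ^+ 4 = #|P|%:R ^+ 3 * (q ^+ 2 * #|P|%:R) by ring.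
rewrite ler_wpM2r ?mulr_ge0 ?exprn_ge0 ?ler0n // -natrX ler_nat.
rewrite (_ : (#|P| ^ 3)%N = #|setX (setX P P) P|); last first.
  by rewrite !cardsX !expnS mulnA expn0 muln1.
apply: subset_leq_card; apply/subsetP => -[[a b] c] /and4P[/= aP bP cP _].
by rewrite !inE aP bP cP.
Qed.

(** Either n is at most one of 12, 4|P|/q, t, or n t^4 <= n^5 and [rich_fifth_power] applies. *)
Lemma incidence_bound P (A : {set 'rV[F]_6}) (t : R) :
  0 < t -> {in A, forall w, no_three_collinear w} ->
  \sum_(w in A) #|zeros P w|%:R <=
    (12 + 4 * #|P|%:R / q + t) * #|A|%:R + 8 * q ^+ 2 * #|P|%:R ^+ 4 / t ^+ 4.
Proof.
move=> t0 A3.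
pose S w : R := \sum_(t | distinct_triples (zeros P w) t) deviation P w t ^+ 2.
have S0 w : 0 <= S w by apply: sumr_ge0 => u _; exact: sqr_ge0.
apply: le_trans (_ : \sum_(w in A)
    ((12 + 4 * #|P|%:R / q + t) + 8 * S w / t ^+ 4) <= _); last first.
  rewrite big_split /= sumr_const -[_ *+ _]mulr_natr lerD2l.
  rewrite -mulr_suml -mulr_sumr ler_pM2r ?invr_gt0 ?exprn_gt0 //.
  by rewrite -mulrA ler_pM2l //; exact: sum_fifth_powers.
apply: ler_sum => w wA; set n : R := #|_|%:R.
have Pq0 : 0 <= 4 * #|P|%:R / q by rewrite divr_ge0 ?mulr_ge0 ?ler0n ?ltW.
have St0 : 0 <= 8 * S w / t ^+ 4.
  by rewrite divr_ge0 ?mulr_ge0 ?ler0n ?S0 ?exprn_ge0 ?ltW.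
have [n12|n12] := lerP 12 n; last by lra.
have [nP|nP] := lerP (4 * #|P|%:R / q) n; last by lra.
have [nt|nt] := lerP n t; first by lra.
suff : n <= 8 * S w / t ^+ 4 by lra.
rewrite ler_pdivlMr ?exprn_gt0 //.
apply: le_trans (rich_fifth_power (A3 _ wA) n12 nP).
by rewrite [leRHS]exprS ler_wpM2l ?ler0n // lerXn2r ?nnegrE ?ler0n ?ltW.
Qed.

End Moment.

(** * Conics and their equations *)

Section Curves.
Variable F : finFieldType.
Implicit Types (p : 'rV[F]_2) (w : 'rV[F]_6) (c : curve F).

Lemma irreducible_conic_quad c : irreducible_conic c ->
  exists2 w, c = curve_of (quad w) & no_three_collinear w /\ w != 0.
Proof.
move=> [g [-> g3 girr]]; have [|w gw] := @msize_le3_quad F g; first by rewrite g3.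
exists w; rewrite -?gw //; split.
  move=> a b d ab ad bd; apply: irreducible_conic_no_three_collinear => //;
  by rewrite -gw.
by apply: contraTneq isT => w0; case: girr => /eqP []; rewrite gw w0 quad0.
Qed.

Lemma on_curve_quad w p : on_curve p (curve_of (quad w)) = (qeval w p == 0).
Proof. by rewrite on_curve_of meval_quad. Qed.

(** The equations are the nonzero multiples of one nonzero vector, by [quad_inj]. *)
Lemma card_equations c : irreducible_conic c ->
  #|[set w | curve_of (quad w) == c]| = #|F|.-1.
Proof.
move=> /irreducible_conic_quad [w0 -> [_ w00]].
rewrite -(cardsC1 (0 : F)) -(card_in_imset (f := fun k : F => k *: w0)).
  apply: eq_card => w; rewrite inE; apply/eqP/imsetP.
    move=> /esym/curve_of_eq [k k0 wE]; exists k; first by rewrite !inE.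
    by apply: quad_inj; rewrite wE quadZ.
  move=> [k]; rewrite !inE => k0 ->; apply/esym/curve_of_eq.
  by exists k; rewrite ?quadZ.
move=> k l _ _ kl; apply/eqP; rewrite -subr_eq0.
have /eqP : (k - l) *: w0 = 0 by rewrite scalerBl kl subrr.
by rewrite scaler_eq0 (negPf w00) orbF.
Qed.

(** This moves sums over conics to sums over coefficient vectors, where the moment bound lives. *)
Lemma sum_over_equations (R : nmodType) (C : {fset curve F}) (f : curve F -> R) :
  (forall c, c \in C -> irreducible_conic c) ->
  \sum_(w | curve_of (quad w) \in C) f (curve_of (quad w))
    = \sum_(c <- C) f c *+ #|F|.-1.
Proof.
move=> Cirr; transitivity (\sum_(w : 'rV[F]_6) \sum_(c <- C | curve_of (quad w) == c) f c).
  rewrite big_mkcond; apply: eq_bigr => w _; case: ifPn => wC.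
    have eqC : pred1 (curve_of (quad w)) =1 (fun c => curve_of (quad w) == c).
      by move=> c; exact: eq_sym.
    by rewrite -big_filter -(eq_filter eqC) filter_pred1_uniq ?fset_uniq // big_seq1.
  by rewrite big_seq_cond big1 // => c /andP[cC /eqP wc]; rewrite wc cC in wC.
rewrite (exchange_big_dep predT) //= big_seq [RHS]big_seq; apply: eq_bigr => c cC.
rewrite -(card_equations (Cirr _ cC)) -sumr_const; apply: eq_bigl => w.
by rewrite inE.
Qed.

Lemma incidencesE (P : {fset 'rV[F]_2}) (C : {fset curve F}) :
  incidences P C = (\sum_(c <- C) #|[set p | (p \in P) && on_curve p c]|)%N.
Proof.
rewrite /incidences card_fset_sum1 big_fset /= /fsetM.
rewrite big_mkcond big_imfset2 /=; last by move=> [u1 u2] [v1 v2] _ _ /= [-> ->].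
rewrite exchange_big; apply: eq_bigr => c _; rewrite -big_mkcond /= -sum1_card.
rewrite -big_filter -[RHS]big_filter.
apply: perm_big; apply: uniq_perm;
  rewrite ?filter_uniq ?index_enum_uniq ?fset_uniq // => p.
by rewrite !mem_filter inE mem_index_enum andbT andbC.
Qed.

End Curves.

(** * Choice of the threshold and conclusion *)

Theorem theorem1p5 (R : realType) :
  exists K : R, 0 < K /\
    forall (F : finFieldType) (P : {fset 'rV[F]_2}) (C : {fset curve F}),
      (forall c : curve F, c \in C -> irreducible_conic c) ->
      (incidences P C)%:R <=
        K * (#|` P|%:R * #|` C|%:R / #|F|%:R
             + #|F|%:R `^ (1 / 5) * #|` P|%:R `^ (4 / 5) * #|` C|%:R `^ (4 / 5)
             + #|` C|%:R).
Proof.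
(* Since q <= 2(q - 1), the tail 8q costs at most 16(q - 1), and the threshold term adds one
   more. *)
exists 17; split=> [|F P C Cirr]; first by [].
set x : R := #|` P|%:R; set y : R := #|` C|%:R; set q : R := #|F|%:R.
have F_gt1 : (1 < #|F|)%N by exact: card_finNzRing_gt1.
have q2 : 2 <= q by rewrite ler_nat.
have q0 : 0 < q by apply: lt_le_trans q2.
have x0 : 0 <= x by rewrite ler0n.
have y0 : 0 <= y by rewrite ler0n.
have rhs0 : 0 <= 17 * (x * y / q + q `^ (1 / 5) * x `^ (4 / 5) * y `^ (4 / 5) + y).
  by rewrite mulr_ge0 // !addr_ge0 ?divr_ge0 ?mulr_ge0 ?powR_ge0 // ltW.
have incP := incidencesE P C.
(* Empty sets are treated apart because the threshold must be positive and has a root of y as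
   denominator. *)
have [y_eq0|y_neq0] := eqVneq y 0.
  have C0 : C = fset0 by apply/eqP; rewrite -cardfs_eq0 -(pnatr_eq0 R); apply/eqP.
  by rewrite incP C0 big_seq_fset0.
have [x_eq0|x_neq0] := eqVneq x 0.
  have P0 : P = fset0 by apply/eqP; rewrite -cardfs_eq0 -(pnatr_eq0 R); apply/eqP.
  rewrite incP big1 // => c _; rewrite P0; apply/eqP; rewrite cards_eq0.
  by apply/eqP/setP => p; rewrite !inE.
have x_gt0 : 0 < x by rewrite lt_def x_neq0.
have y_gt0 : 0 < y by rewrite lt_def y_neq0.
pose a := q `^ (1 / 5); pose b := x `^ (1 / 5); pose g := y `^ (1 / 5).
have fifth z : 0 <= z -> (z `^ (1 / 5)) ^+ 5 = z.
  by move=> z0; rewrite -powR_mulrn ?powR_ge0 // -powRrM mul1r mulVf ?pnatr_eq0 ?powRr1.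
have fourth z : z `^ (4 / 5) = (z `^ (1 / 5)) ^+ 4.
  by rewrite -powR_mulrn ?powR_ge0 // -powRrM mul1r mulrC.
have qa : q = a ^+ 5 by rewrite fifth // ltW.
have xb : x = b ^+ 5 by rewrite fifth.
have yg : y = g ^+ 5 by rewrite fifth.
have a0 : 0 < a by exact: powR_gt0.
have b0 : 0 < b by exact: powR_gt0.
have g0 : 0 < g by exact: powR_gt0.
rewrite !fourth -/a -/b -/g.
pose A := [set w | curve_of (quad w) \in C].
pose Q := [set p in P].
have Q_card : #|Q|%:R = x.
  by rewrite /x card_fset_sum1 -sum1_card; congr (_%:R);
     rewrite -big_filter; apply: perm_big; apply: uniq_perm;
     rewrite ?filter_uniq ?index_enum_uniq ?fset_uniq // => p;
     rewrite mem_filter inE mem_index_enum andbT.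
have pred_q : #|F|.-1%:R = q - 1 by rewrite -subn1 natrB // ltnW.
have A_card : #|A|%:R = (q - 1) * y.
  transitivity (\sum_(w | curve_of (quad w) \in C) (1 : R)).
    by rewrite sumr_const; congr (_%:R); apply: eq_card => w; rewrite inE.
  rewrite (sum_over_equations (fun=> 1) Cirr) big_const_seq count_predT iter_addr_0.
  by rewrite -[LHS]mulr_natr pred_q.
have I_card : \sum_(w in A) #|zeros Q w|%:R = (q - 1) * (incidences P C)%:R.
  rewrite incP natr_sum mulr_sumr.
  rewrite [RHS](eq_bigr (fun c => #|[set p | (p \in P) && on_curve p c]|%:R *+ #|F|.-1)).
    rewrite -(sum_over_equations (fun c => #|[set p | (p \in P) && on_curve p c]|%:R : R)) //.
    apply: eq_big => [w|w _]; first by rewrite inE.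
    by congr (_%:R); apply: eq_card => p; rewrite !inE on_curve_quad.
  by move=> c _; rewrite -[RHS]mulr_natl pred_q.
(* This threshold balances t y against q x^4 / t^4: both equal a b^4 g^4. *)
have t0 : 0 < a * b ^+ 4 / g by rewrite divr_gt0 ?mulr_gt0 ?exprn_gt0.
have A3 : {in A, forall w, no_three_collinear w}.
  move=> w; rewrite inE => wC.
  (* The property is known for one equation [w'] of the conic; [w] has the same zeros. *)
  have [w' ww' [w'3 _]] := irreducible_conic_quad (Cirr _ wC).
  have zE p : qeval w p = 0 -> qeval w' p = 0.
    by move=> /eqP; rewrite -on_curve_quad ww' on_curve_quad => /eqP.
  by move=> c d e cd ce de /zE wc /zE wd /zE we; exact: w'3.
have := incidence_bound Q t0 A3.
rewrite I_card A_card Q_card -/q.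
set I : R := (incidences P C)%:R; set t := _ / g => bound.
have q1 : 0 < q - 1 by lra.
have main0 : 0 <= a * b ^+ 4 * g ^+ 4 by rewrite !mulr_ge0 ?exprn_ge0 ?ltW.
have ty : t * y = a * b ^+ 4 * g ^+ 4.
  by rewrite /t yg; field; rewrite gt_eqF.
have tail : 8 * q ^+ 2 * x ^+ 4 / t ^+ 4 = 8 * q * (a * b ^+ 4 * g ^+ 4).
  by rewrite /t qa xb; field; rewrite !gt_eqF.
have xyq0 : 0 <= x * y / q by rewrite divr_ge0 ?mulr_ge0 // ltW.
(* The factor q - 1 counts the equations of each conic and absorbs the extra q in [tail]. *)
rewrite -(ler_pM2l q1); apply: (le_trans bound); rewrite tail.
have -> : (12 + 4 * x / q + t) * ((q - 1) * y) =
    (q - 1) * (12 * y + 4 * (x * y / q) + t * y) by field; rewrite gt_eqF.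
rewrite ty; nra.
Qed.
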